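(* Let $\mathcal{G}=(\mathcal{V},\mathcal{E},A)$ be a strongly connected signed digraph on $n$ nodes with Laplacian matrix $L$, and let $W=\mathrm{diag}\{\det(\overline{L}_{11}),\dots,\det(\overline{L}_{nn})\}$, where $\overline{L}$ is the Laplacian matrix of the induced unsigned digraph of $\mathcal{G}$. Consider the system $$\dot{x}(t)=-WLx(t),\qquad x(t)\in\mathbb{R}^n .$$ Then this system achieves 1) signed-average consensus if and only if $\mathcal{G}$ is structurally balanced; 2) state stability if and only if $\mathcal{G}$ is structurally unbalanced.
   Context: Write $\mathcal{F}_n=\{1,\dots,n\}$. A signed digraph $\mathcal{G}=(\mathcal{V},\mathcal{E},A)$ has node set $\mathcal{V}=\{v_1,\dots,v_n\}$, edge set $\mathcal{E}\subseteq\mathcal{V}\times\mathcal{V}$, and real weight matrix $A=[a_{ij}]\in\mathbb{R}^{n\times n}$ with $a_{ij}\neq0\Leftrightarrow(v_j,v_i)\in\mathcal{E}$. Standing assumptions: no self-loops ($a_{ii}=0$ for all $i$) and digon sign-symmetry ($a_{ij}a_{ji}\ge0$ for all $i,j$). $\mathcal{G}$ is strongly connected if there is a directed path between every ordered pair of distinct nodes. $\mathcal{G}$ is structurally balanced if $\mathcal{V}$ is the union of two disjoint subsets $\mathcal{V}_1,\mathcal{V}_2$ (either may be empty) with $a_{ij}\ge0$ whenever $v_i,v_j$ lie in the same subset and $a_{ij}\le0$ whenever they lie in different subsets; otherwise $\mathcal{G}$ is structurally unbalanced. The Laplacian of $\mathcal{G}$ is $L=\Delta-A$, where $\Delta=\mathrm{diag}\{\sum_{j=1}^n|a_{1j}|,\dots,\sum_{j=1}^n|a_{nj}|\}$.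 The induced unsigned digraph is $\overline{\mathcal{G}}=(\mathcal{V},\mathcal{E},\overline{A})$ with $\overline{A}=[|a_{ij}|]$; its Laplacian is $\overline{L}=\Delta-\overline{A}$. $\overline{L}_{ii}\in\mathbb{R}^{(n-1)\times(n-1)}$ denotes $\overline{L}$ with its $i$th row and $i$th column removed. A system with state $x(t)=[x_1(t),\dots,x_n(t)]^T$ achieves signed-average consensus if for every initial state $x(0)=[x_{10},\dots,x_{n0}]^T\in\mathbb{R}^n$ there exist $\sigma_1,\dots,\sigma_n\in\{\pm1\}$ such that $\lim_{t\to\infty}x_i(t)=\frac{\sigma_i}{n}\sum_{j=1}^n\sigma_jx_{j0}$ for all $i\in\mathcal{F}_n$. It achieves state stability if for every initial state $\lim_{t\to\infty}x_i(t)=0$ for all $i\in\mathcal{F}_n$. *)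

(* Defs.v *)
From HB Require Import structures.
From mathcomp Require Import all_boot all_order all_algebra.
From mathcomp Require Import all_classical all_reals all_analysis.

Set Implicit Arguments.
Unset Strict Implicit.
Unset Printing Implicit Defensive.

Import Order.TTheory GRing.Theory Num.Theory.
Import numFieldNormedType.Exports.

Local Open Scope classical_set_scope.
Local Open Scope ring_scope.

(* The nodes v_1, ..., v_n are the elements of 'I_n, and [edge G j i] means
   (v_j, v_i) \in E: the entry in row i, column j of the weight matrix is the
   weight of the edge from v_j to v_i. *)
Record signed_digraph (R : realType) (n : nat) := SignedDigraph {
  weight : 'M[R]_n;
  edge : rel 'I_n;
  weight_edge : forall i j, weight i j != 0 <-> edge j i;
  weight_no_loop : forall i, weight i i = 0;
  weight_digon : forall i j, 0 <= weight i j * weight j i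
}.

Section SignedDigraph.
Context {R : realType} {n : nat}.
Implicit Types (G : signed_digraph R n) (M : 'M[R]_n).

Definition strongly_connected G : Prop :=
  forall i j, i != j -> connect (edge G) i j.

Definition structurally_balanced G : Prop :=
  exists V1 V2 : {set 'I_n},
    [/\ V1 :|: V2 = [set: 'I_n]%SET,
        V1 :&: V2 = finset.set0,
        (forall i j, (i \in V1 /\ j \in V1) \/ (i \in V2 /\ j \in V2) ->
           0 <= weight G i j) &
        (forall i j, (i \in V1 /\ j \in V2) \/ (i \in V2 /\ j \in V1) ->
           weight G i j <= 0)].

Definition structurally_unbalanced G : Prop := ~ structurally_balanced G.

Definition laplacian G : 'M[R]_n :=
  diag_mx (\row_i \sum_j `|weight G i j|) - weight G.

Lemma unsigned_weight_edge G i j :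
  map_mx Num.norm (weight G) i j != 0 <-> edge G j i.
Proof. by rewrite mxE normr_eq0; exact: weight_edge. Qed.

Lemma unsigned_no_loop G i : map_mx Num.norm (weight G) i i = 0.
Proof. by rewrite mxE weight_no_loop normr0. Qed.

Lemma unsigned_digon G i j :
  0 <= map_mx Num.norm (weight G) i j * map_mx Num.norm (weight G) j i.
Proof. by rewrite !mxE mulr_ge0. Qed.

Definition induced_unsigned G : signed_digraph R n :=
  SignedDigraph (unsigned_weight_edge G) (unsigned_no_loop G)
                (unsigned_digon G).

Definition principal_minor M (i : 'I_n) : R := \det (row' i (col' i M)).

Definition minor_gain G : 'M[R]_n :=
  diag_mx (\row_i principal_minor (laplacian (induced_unsigned G)) i).

(* [x] solves x' = M x on [0, +oo[ with x(0) = x0: it is differentiable on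
   ]0, +oo[ and right-continuous at 0; its values at negative times are
   irrelevant. *)
Definition trajectory M (x0 : 'cV[R]_n) (x : R -> 'cV[R]_n) : Prop :=
  [/\ x 0 = x0,
      (forall i, x t i 0 @[t --> 0^'+] --> x0 i 0) &
      (forall (t : R) i, 0 < t ->
         is_derive t 1 (fun s => x s i 0) ((M *m x t) i 0))].

Definition signed_average_consensus M : Prop :=
  forall x0 : 'cV[R]_n, exists sigma : 'I_n -> R,
    (forall i, sigma i = 1 \/ sigma i = -1) /\
    (forall x, trajectory M x0 x ->
       forall i, x t i 0 @[t --> +oo] -->
         sigma i / n%:R * \sum_j sigma j * x0 j 0).

Definition state_stability M : Prop :=
  forall (x0 : 'cV[R]_n) x, trajectory M x0 x ->
    forall i, x t i 0 @[t --> +oo] --> (0 : R).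

End SignedDigraph.

(* Main.v *)
(** Write w_i for the i-th principal minor of the unsigned Laplacian Lbar.
    By the maximum principle, strong connectivity forces ker Lbar to consist of
    the constants; since Lbar * adj Lbar = 0, every row of the adjugate is then
    (w_1, ..., w_n), and adj Lbar * Lbar = 0 says that w is a left null vector.
    The same principle shows that a principal submatrix plus s I is invertible
    for s >= 0, so its determinant cannot change sign and w_i > 0.

    Left nullity makes |x|^2 a Lyapunov function:
      d/dt |x|^2 = - sum_ij w_i |a_ij| (x_i - sg(a_ij) x_j)^2.
    In the unbalanced case this form is definite, so the energy decays
    exponentially.  In the balanced case its kernel is spanned by the gauge
    vector sigma while sum_i sigma_i x_i is conserved, so the component of x
    orthogonal to sigma decays.  Disproving consensus for an unbalanced graph
    needs a solution starting from a basis vector: the exponential series. *)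
Require Import Defs.
From mathcomp Require Import all_boot all_order all_algebra.
From mathcomp Require Import all_classical all_reals all_analysis.
From mathcomp Require Import ring.

Set Implicit Arguments.
Unset Strict Implicit.
Unset Printing Implicit Defensive.

Import Order.TTheory GRing.Theory Num.Theory.
Import numFieldNormedType.Exports.

Local Open Scope classical_set_scope.
Local Open Scope ring_scope.

(** * Propagation along paths and positivity of determinants *)

Lemma connect_all (T : finType) (e : rel T) (P : pred T) x :
  (forall y, connect e x y) -> P x -> (forall y z, e y z -> P y -> P z) ->
  forall y, P y.
Proof.
move=> xe Px stepP y; have /connectP[p + ->] := xe y.
elim: p x {xe} Px => //= z p IHp x Px /andP[xz zp].
exact: IHp (stepP _ _ xz Px) zp.
Qed.

(* The step hypothesis is only available away from the root [x], where the
   Laplacian equation holds. *)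
Lemma connect_all_rev (T : finType) (e : rel T) (P : pred T) x y :
  connect e x y -> P y -> (forall u v, e u v -> v != x -> P v -> P u) -> P x.
Proof.
move=> /connectP[p + ->] => {y}.
elim/last_ind: p => //= p z IHp; rewrite rcons_path last_rcons => /andP[xp ez].
move=> Pz stepP; have [<-//|zx] := eqVneq z x.
by apply: IHp => //; exact: stepP ez zx Pz.
Qed.

(** A monic polynomial is positive beyond its Cauchy bound, so a nonpositive value at 0 would force
    a nonnegative root by the intermediate value theorem. *)
Lemma monic_gt0_of_no_root (R : rcfType) (p : {poly R}) : p \is monic ->
  (forall x, 0 <= x -> ~~ root p x) -> 0 < p.[0].
Proof.
move=> mp noroot; rewrite ltNge; apply/negP => p0.
have [b pb] := monic_Cauchy_bound mp.
have /pb/ltW pm : b <= Num.max 0 b by rewrite le_max lexx orbT.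
have m0 : 0 <= Num.max 0 b by rewrite le_max lexx.
have [|x /andP[x0 _] rx] := @poly_ivt _ p 0 _ m0; first by rewrite p0 pm.
by move: (noroot x); rewrite rx => /(_ x0).
Qed.

(* [char_poly (- B^T)] evaluates to [\det (s%:M + B)] at [s]; it is monic and
   has no nonnegative root. *)
Lemma det_gt0_of_shift (R : rcfType) m (B : 'M[R]_m) :
  (forall (s : R) (y : 'cV_m), 0 <= s -> s *: y + B *m y = 0 -> y = 0) ->
  0 < \det B.
Proof.
move=> Binj.
have -> : \det B = (char_poly (- B^T)).[0].
  rewrite horner_coef0 char_poly_det -(scaleN1r B^T) detZ det_tr mulrA -exprD.
  by rewrite addnn -mul2n exprM sqrrN !expr1n mul1r.
apply: monic_gt0_of_no_root; first exact: char_poly_monic.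
move=> s s0; rewrite -eigenvalue_root_char; apply/negP => /eigenvalueP[v vB].
move/negP; apply; rewrite -(trmxK v) (_ : v^T = 0) ?trmx0//.
apply: (Binj s) => //; apply: trmx_inj.
by rewrite linearD linearZ /= trmx_mul trmxK -vB mulmxN trmx0 addNr.
Qed.

(** * Kernel, principal minors and left null vector of the unsigned Laplacian *)

Section Graph.
Context {R : realType} {n : nat} (G : signed_digraph R n).
Hypothesis hG : strongly_connected G.
Local Notation a := (weight G).
Local Notation Lbar := (laplacian (induced_unsigned G)).
Local Notation w := (principal_minor Lbar).

Lemma strongly_connectedW i j : connect (edge G) i j.
Proof. by have [->|/hG] := eqVneq i j; first exact: connect0. Qed.

Lemma laplacianE (H : signed_digraph R n) (x : 'cV_n) i :
  (laplacian H *m x) i 0 =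
  \sum_j (`|weight H i j| * x i 0 - weight H i j * x j 0).
Proof. by rewrite mulmxBl mul_diag_mx !mxE sumrB -mulr_suml. Qed.

Lemma unsigned_laplacian_entry i j :
  Lbar i j = (\sum_k `|a i k|) *+ (i == j) - `|a i j|.
Proof.
rewrite !mxE; congr (_ *+ _ - _).
by apply: eq_bigr => k _; rewrite mxE normr_id.
Qed.

Lemma unsigned_laplacianE (x : 'cV_n) i :
  (Lbar *m x) i 0 = \sum_j `|a i j| * (x i 0 - x j 0).
Proof.
by rewrite laplacianE; apply: eq_bigr => j _; rewrite !mxE normr_id mulrBr.
Qed.

(* Grounding node [j] allows one statement to serve both for the kernel of
   [Lbar] ([s = 0]) and for the principal submatrix at [j]. *)
Lemma grounded_maximum (s : R) (x : 'cV_n) j : 0 <= s -> x j 0 = 0 ->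
  (forall i, i != j -> s * x i 0 + (Lbar *m x) i 0 = 0) ->
  forall i, x i 0 <= 0.
Proof.
move=> s0 xj0 hx i.
case: (@Order.TotalTheory.arg_maxP _ _ _ j xpredT (fun i => x i 0)) => //.
move=> m _ mmax.
have xm k : x k 0 <= x m 0 by exact: mmax.
apply: (le_trans (xm i)).
suff /eqP <- : x j 0 == x m 0 by rewrite xj0.
(* The set where the maximum is attained spreads backwards along edges until it reaches [j]: at a
   maximal node [v] other than [j], the equation is a sum of nonnegative terms equal to 0, so each
   in-neighbour of [v] is maximal too. *)
apply: (connect_all_rev (P := fun u => x u 0 == x m 0)
  (strongly_connectedW j m)) => // u v euv vj /eqP xv.
have := hx _ vj; rewrite unsigned_laplacianE.
have term k : 0 <= `|a v k| * (x v 0 - x k 0).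
  by rewrite mulr_ge0// xv subr_ge0.
move/eqP; rewrite paddr_eq0 ?sumr_ge0//; last by rewrite mulr_ge0// xv -xj0.
case/andP=> _; rewrite psumr_eq0//.
move/allP/(_ u (mem_index_enum _))/implyP/(_ isT).
rewrite mulf_eq0 normr_eq0 (negPf (proj2 (weight_edge G v u) euv)) /= subr_eq0.
by rewrite xv eq_sym.
Qed.

(** The maximum principle applies to both [x] and [- x]. *)
Lemma grounded_eq0 (s : R) (x : 'cV_n) j : 0 <= s -> x j 0 = 0 ->
  (forall i, i != j -> s * x i 0 + (Lbar *m x) i 0 = 0) -> x = 0.
Proof.
move=> s0 xj0 hx; apply/colP => i; rewrite !mxE; apply/eqP.
rewrite eq_le (grounded_maximum s0 xj0 hx) /= -oppr_le0.
have := @grounded_maximum s (- x) j s0; rewrite mxE xj0 oppr0 => /(_ erefl).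
move=> /(_ _ i); rewrite mxE; apply => k kj.
rewrite mulmxN [(- x) k 0]mxE [(- (Lbar *m x)) k 0]mxE mulrN -opprD.
by rewrite hx// oppr0.
Qed.

Lemma unsigned_laplacian_ker (x : 'cV_n) :
  Lbar *m x = 0 -> forall i j, x i 0 = x j 0.
Proof.
move=> Lx i j; apply/eqP; rewrite -subr_eq0; apply/eqP.
have : x - const_mx (x j 0) = 0.
  apply: (@grounded_eq0 0 _ j) => //; first by rewrite !mxE subrr.
  move=> k _; rewrite mul0r add0r mulmxBr Lx sub0r mxE unsigned_laplacianE.
  by rewrite big1 ?oppr0// => l _; rewrite !mxE subrr mulr0.
by move/colP/(_ i); rewrite !mxE.
Qed.

(** A vector on the nodes other than [i] is extended by 0 at [i]. The principal submatrix acts on it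
    as [Lbar] does off [i], so grounding at [i] gives injectivity for every shift. *)
Lemma unsigned_minor_gt0 i : 0 < w i.
Proof.
apply: det_gt0_of_shift => s y s0 hy.
have [x [xi xl]] : exists x : 'cV[R]_n,
    x i 0 = 0 /\ forall k, x (lift i k) 0 = y k 0.
  exists (\col_k oapp (fun l => y l 0) 0 (unlift i k)).
  by split=> [|k]; rewrite mxE ?unlift_none ?liftK.
suff x0 : x = 0 by apply/colP => k; rewrite -xl x0 !mxE.
apply: (@grounded_eq0 s _ i) => // k; rewrite eq_sym => /unlift_some[l -> _].
move: hy; move: (Lbar) => L /colP/(_ l).
rewrite !mxE xl => hyl; rewrite -[RHS]hyl; congr (_ + _).
rewrite (bigD1_ord i) //= xi mulr0 add0r.
by apply: eq_bigr => m _; rewrite xl !mxE.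
Qed.

Lemma minor_left_kernel j : \sum_i w i * Lbar i j = 0.
Proof.
have L1 : Lbar *m (const_mx 1 : 'cV_n) = 0.
  apply/colP => i; rewrite unsigned_laplacianE [RHS]mxE big1// => k _.
  by rewrite !mxE subrr mulr0.
have det0 : \det Lbar = 0.
  rewrite -det_tr; apply/eqP/det0P; exists (const_mx 1); last first.
    by rewrite -[RHS]trmx0 -L1 trmx_mul trmx_const.
  by apply/eqP => /rowP/(_ j); rewrite !mxE; apply/eqP; rewrite oner_eq0.
(* Column [i] of the adjugate lies in the kernel of [Lbar], hence is constant; its diagonal entry is
   the cofactor [w i], with sign +1. *)
have adjE i : \adj Lbar j i = w i.
  have /unsigned_laplacian_ker/(_ j i) : Lbar *m col i (\adj Lbar) = 0.
    by rewrite !colE mulmxA mul_mx_adj det0 -scalemx1 scale0r mul0mx.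
  by rewrite !mxE => ->; rewrite /cofactor -signr_odd oddD addbb mul1r.
have : (\adj Lbar *m Lbar) j j = 0 by rewrite mul_adj_mx det0 mxE mul0rn.
by rewrite mxE => adjL; rewrite -[RHS]adjL; apply: eq_bigr => i _; rewrite adjE.
Qed.

(** The left null vector read as a flow balance at node [j]: this lets the squares at heads and
    tails of edges be exchanged in the energy. *)
Lemma minor_balance j :
  \sum_i w i * `|a i j| = w j * \sum_k `|a j k|.
Proof.
apply/esym/eqP; rewrite -subr_eq0; apply/eqP.
rewrite -[RHS](minor_left_kernel j).
under [RHS]eq_bigr => i _ do rewrite unsigned_laplacian_entry mulrBr.
rewrite sumrB; congr (_ - _).
rewrite [RHS](bigD1 j)//= eqxx [X in _ + X]big1; last first.
  by move=> i ij; rewrite (negPf ij) mulr0n mulr0.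
by rewrite addr0.
Qed.
End Graph.

(* A left inverse of the matrix of the forms [l t] bounds [x] by their values. *)
Lemma coercive_of_ker0 (R : rcfType) (T : finType) n (l : T -> 'I_n -> R) :
  (forall x : 'cV_n, (forall t, \sum_i l t i * x i 0 = 0) -> x = 0) ->
  exists2 c, 0 < c & forall x : 'cV_n,
    c * \sum_i x i 0 ^+ 2 <= \sum_t (\sum_i l t i * x i 0) ^+ 2.
Proof.
move=> ker0; pose F := \matrix_(k < #|T|, i < n) l (enum_val k) i.
have FE (x : 'cV_n) t :
    (F *m x) (enum_rank t) 0 = \sum_i l t i * x i 0.
  by rewrite mxE; apply: eq_bigr => i _; rewrite mxE enum_rankK.
have /row_fullP[B BF] : row_full F.
  rewrite /row_full -mxrank_tr; apply: inj_row_free => v vF.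
  apply: trmx_inj; rewrite trmx0; apply: ker0 => t; rewrite -FE.
  by rewrite -[F]trmxK -trmx_mul vF !mxE.
(* [C] comes from [x = B F x], where every entry of [F x] is at most the square root of [S]. The
   summand 1 keeps [C] positive even when [B] vanishes. *)
pose C := 1 + \sum_i (\sum_k `|B i k|) ^+ 2.
have C0 : 0 < C by rewrite ltr_pwDl// sumr_ge0// => i _; rewrite sqr_ge0.
exists C^-1; first by rewrite invr_gt0.
move=> x; rewrite mulrC ler_pdivrMr//.
set S := (X in _ <= X * _).
have S0 : 0 <= S by rewrite sumr_ge0// => t _; rewrite sqr_ge0.
have Fx k : `|(F *m x) k 0| <= Num.sqrt S.
  rewrite -sqrtr_sqr ler_sqrt// -(enum_valK k) FE /S (bigD1 (enum_val k))//=.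
  by rewrite lerDl sumr_ge0// => t _; rewrite sqr_ge0.
have xB i : x i 0 ^+ 2 <= (\sum_k `|B i k|) ^+ 2 * S.
  rewrite -[S]sqr_sqrtr// -exprMn -[x i 0 ^+ 2]real_normK ?num_real//.
  rewrite lerXn2r ?nnegrE ?mulr_ge0 ?sumr_ge0 ?sqrtr_ge0//.
  rewrite -[x in leLHS]mul1mx -BF -mulmxA mxE (le_trans (ler_norm_sum _ _ _))//.
  by rewrite mulr_suml ler_sum// => k _; rewrite normrM ler_wpM2l.
rewrite (le_trans (ler_sum _ (fun i _ => xB i)))// -mulr_suml mulrC.
by rewrite ler_wpM2l// /C lerDr.
Qed.

(** * The dissipation form, its kernel, and exponential decay *)

Section Dissipation.
Context {R : realType} {n : nat} (G : signed_digraph R n).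
Hypothesis hG : strongly_connected G.
Local Notation a := (weight G).
Local Notation w := (principal_minor (laplacian (induced_unsigned G))).
Local Notation M := (- (minor_gain G *m laplacian G)).

Definition dissipation (x : 'cV[R]_n) : R :=
  \sum_i \sum_j w i * `|a i j| * (x i 0 - Num.sg (a i j) * x j 0) ^+ 2.

Lemma gained_laplacianE (x : 'cV_n) i :
  (M *m x) i 0 = - (w i * \sum_j (`|a i j| * x i 0 - a i j * x j 0)).
Proof.
rewrite mulNmx -mulmxA mul_diag_mx -laplacianE; move: (laplacian _ *m x) => y.
by rewrite 2!mxE; congr (- (_ * _)); rewrite mxE.
Qed.

(** Expanding the square in [dissipation] gives one cross term and two sums of squares, which
    [minor_balance] makes equal. *)
Lemma energy_dissipation (x : 'cV_n) :
  2 * \sum_i x i 0 * (M *m x) i 0 = - dissipation x.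
Proof.
have balance : \sum_i \sum_j w i * `|a i j| * x j 0 ^+ 2 =
               \sum_i \sum_j w i * `|a i j| * x i 0 ^+ 2.
  rewrite exchange_big; apply: eq_bigr => j _ /=.
  by rewrite -!mulr_suml minor_balance// mulr_sumr.
transitivity (- (\sum_i \sum_j w i * `|a i j| * x i 0 ^+ 2 +
    \sum_i \sum_j w i * `|a i j| * x j 0 ^+ 2 -
    2 * \sum_i \sum_j w i * a i j * x i 0 * x j 0)).
  have factor2 (A B : R) : A + A - 2 * B = 2 * (A - B) by ring.
  rewrite balance factor2 -[RHS]mulrN.
  rewrite -sumrB -sumrN; congr (_ * _); apply: eq_bigr => i _.
  rewrite gained_laplacianE mulrN; congr (- _).
  rewrite mulrCA mulr_sumr -sumrB mulr_sumr; apply: eq_bigr => j _; ring.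
congr (- _); rewrite mulr_sumr -big_split -sumrB /=; apply: eq_bigr => i _.
rewrite mulr_sumr -big_split -sumrB /=; apply: eq_bigr => j _.
case: (sgrP (a i j)) => aij; rewrite ?aij; ring.
Qed.

(** The constraint [tau] serves both cases: it is zero for an unbalanced graph and the gauge vector
    for a balanced one. *)
Lemma dissipation_coercive (tau : 'I_n -> R) :
  (forall x : 'cV_n, (forall i j, edge G j i -> x i 0 = Num.sg (a i j) * x j 0) ->
     \sum_i tau i * x i 0 = 0 -> x = 0) ->
  exists2 c, 0 < c & forall x : 'cV_n, \sum_i tau i * x i 0 = 0 ->
    c * \sum_i x i 0 ^+ 2 <= dissipation x.
Proof.
(* The squares of the forms [Some (i, j)] add up to [dissipation]; [None] carries the constraint and
   contributes 0 where it holds. *)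
move=> ker0; pose l (t : option ('I_n * 'I_n)) k := if t is Some (i, j) then
  Num.sqrt (w i * `|a i j|) * ((i == k)%:R - Num.sg (a i j) * (j == k)%:R)
  else tau k.
have w_ge0 i : 0 <= w i by exact/ltW/unsigned_minor_gt0.
have lE i j (x : 'cV_n) : \sum_k l (Some (i, j)) k * x k 0 =
    Num.sqrt (w i * `|a i j|) * (x i 0 - Num.sg (a i j) * x j 0).
  have delta (m : 'I_n) : \sum_k (m == k)%:R * x k 0 = x m 0.
    rewrite (bigD1 m)//= eqxx mul1r big1 ?addr0// => k.
    by rewrite eq_sym => /negPf->; rewrite mul0r.
  rewrite -[in RHS](delta i) -[in RHS](delta j) mulr_sumr -sumrB mulr_sumr.
  by apply: eq_bigr => k _; rewrite /l; ring.
have [|c c0 hc] := @coercive_of_ker0 R _ _ l.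
  move=> x hx; apply: ker0; last exact: (hx None).
  move=> i j eij; apply/eqP; rewrite -subr_eq0.
  have /eqP := hx (Some (i, j)); rewrite lE mulf_eq0 sqrtr_eq0 leNgt.
  rewrite mulr_gt0 ?unsigned_minor_gt0 ?normr_gt0//.
  exact/(proj2 (weight_edge _ _ _)).
exists c => // x hx; apply: (le_trans (hc x)).
rewrite le_eqVlt (_ : _ == _ = true)//; apply/eqP.
transitivity (\sum_(p : 'I_n * 'I_n) (\sum_k l (Some p) k * x k 0) ^+ 2 +
              (\sum_k l None k * x k 0) ^+ 2).
  rewrite (bigD1 None)//= addrC; congr (_ + _).
  rewrite (reindex_omap Some id) => [|[]//].
  by apply: eq_bigl => p /=; rewrite eqxx.
rewrite hx expr0n addr0 /dissipation pair_big /=; apply: eq_bigr => -[i j] _.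
by rewrite lE exprMn sqr_sqrtr// mulr_ge0.
Qed.

(** A nonzero solution would vanish nowhere, since nonvanishing propagates along edges, and the
    signs of its entries would then split the nodes into a balancing partition. *)
Lemma unbalanced_ker0 (x : 'cV_n) : structurally_unbalanced G ->
  (forall i j, edge G j i -> x i 0 = Num.sg (a i j) * x j 0) -> x = 0.
Proof.
move=> unbal hx; apply: contrapT => xn0; apply: unbal.
have [k xk] : exists k, x k 0 != 0.
  apply: contrapT => /forallNP x0; apply: xn0; apply/colP => i; rewrite mxE.
  by apply/eqP/negPn/negP; exact: x0.
have x_neq0 : forall i, x i 0 != 0.
  apply: (connect_all (strongly_connectedW hG k)) => // u v euv xu.
  rewrite (hx _ _ euv) mulf_neq0// sgr_eq0.
  exact/(proj2 (weight_edge _ _ _)).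
have ax i j : 0 <= a i j * (x i 0 * x j 0).
  have [->|/(weight_edge G i j)/hx->] := eqVneq (a i j) 0; first by rewrite mul0r.
  have -> : a i j * (Num.sg (a i j) * x j 0 * x j 0) = `|a i j| * x j 0 ^+ 2.
    by rewrite [in RHS]normrEsg; ring.
  by rewrite mulr_ge0 ?sqr_ge0.
exists [set i | 0 < x i 0]%SET, [set i | x i 0 < 0]%SET; split.
- by apply/setP => i; rewrite !inE -neq_lt eq_sym x_neq0.
- by apply/setP => i; rewrite !inE; case: ltgtP.
- move=> i j; rewrite !inE => ij; move: (ax i j); rewrite pmulr_lge0//.
  by case: ij => -[xi xj]; [exact: mulr_gt0|rewrite nmulr_lgt0].
- move=> i j; rewrite !inE => ij; move: (ax i j); rewrite nmulr_lge0//.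
  by case: ij => -[xi xj]; [rewrite pmulr_rlt0|rewrite nmulr_rlt0].
Qed.

Lemma balanced_gauge : structurally_balanced G ->
  exists sigma : 'I_n -> R, (forall i, sigma i = 1 \/ sigma i = -1) /\
    forall i j, a i j * sigma j = `|a i j| * sigma i.
Proof.
move=> [V1 [V2 [V12 _ pos neg]]].
have V2E i : i \notin V1 -> i \in V2.
  have : i \in V1 :|: V2 by rewrite V12 finset.in_setT.
  by rewrite finset.in_setU => /orP[->|].
exists (fun i => if i \in V1 then 1 else -1); split.
  by move=> i; case: ifP; [left|right].
move=> i j; case: ifP => [j1|/negbT/V2E j2]; case: ifP => [i1|/negbT/V2E i2].
- by rewrite ger0_norm// pos//; left.
- by rewrite ler0_norm ?mulrN1 ?opprK ?mulr1// neg//; right.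
- by rewrite ler0_norm ?mulrN1 ?mulr1// neg//; left.
- by rewrite ger0_norm// pos//; right.
Qed.

Section Gauge.
Variable sigma : 'I_n -> R.
Hypothesis sigma_pm1 : forall i, sigma i = 1 \/ sigma i = -1.
Hypothesis sigma_gauge : forall i j, a i j * sigma j = `|a i j| * sigma i.

Lemma gauge_sqr i : sigma i * sigma i = 1.
Proof. by case: (sigma_pm1 i) => ->; rewrite ?mulrNN mulr1. Qed.

Lemma gained_laplacian_gauge : M *m (\col_i sigma i) = 0.
Proof.
apply/colP => i; rewrite gained_laplacianE big1 ?mulr0 ?oppr0 ?mxE// => j _.
by rewrite !mxE sigma_gauge subrr.
Qed.

(** Moving [sigma] across [a] turns the signed weights into absolute ones, where [minor_balance]
    gives the cancellation. *)
Lemma gauge_conserved (x : 'cV_n) : \sum_i sigma i * (M *m x) i 0 = 0.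
Proof.
have gauge' i j : sigma i * a i j = `|a i j| * sigma j.
  have -> : sigma i * a i j = sigma i * (a i j * sigma j) * sigma j.
    by rewrite -!mulrA gauge_sqr mulr1.
  by rewrite sigma_gauge; ring: (gauge_sqr i).
transitivity (\sum_i \sum_j w i * `|a i j| * (sigma j * x j 0) -
    \sum_i \sum_j w i * `|a i j| * (sigma i * x i 0)).
  rewrite -sumrB; apply: eq_bigr => i _; rewrite gained_laplacianE -sumrB.
  rewrite mulr_sumr -sumrN mulr_sumr; apply: eq_bigr => j _.
  by ring: (gauge' i j).
rewrite exchange_big -sumrB big1 // => j _ /=.
by rewrite -!mulr_suml minor_balance// -mulr_sumr subrr.
Qed.

(** The products [sigma i * x i 0] are constant along edges, so the constraint says that [n] times
    their common value is 0. *)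
Lemma gauge_ker0 (x : 'cV_n) :
  (forall i j, edge G j i -> x i 0 = Num.sg (a i j) * x j 0) ->
  \sum_i sigma i * x i 0 = 0 -> x = 0.
Proof.
move=> hx sx0; apply/colP => k.
have eqk : forall i, sigma i * x i 0 == sigma k * x k 0.
  apply: (connect_all (strongly_connectedW hG k)) => // u v euv /eqP <-.
  have /(proj2 (weight_edge G v u)) avu := euv.
  have -> : sigma v = Num.sg (a v u) * sigma u.
    apply: (mulfI (x := `|a v u|)); first by rewrite normr_eq0.
    by rewrite -sigma_gauge mulrA [`|_| * _]mulrC -numEsg.
  by rewrite (hx _ _ euv) mulrACA -expr2 sqr_sg avu mul1r.
have n0 : (0 < n)%N by exact: leq_ltn_trans (ltn_ord k).
have : \sum_i sigma i * x i 0 = n%:R * (sigma k * x k 0).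
  rewrite (eq_bigr (fun=> sigma k * x k 0)) => [|i _]; last exact/eqP.
  by rewrite sumr_const card_ord mulr_natl.
rewrite sx0 mxE => /esym/eqP; rewrite !mulf_eq0 pnatr_eq0 gtn_eqF//=.
case/orP => /eqP// s0; have := gauge_sqr k; rewrite s0 mul0r => /esym/eqP.
by rewrite oner_eq0.
Qed.
End Gauge.
End Dissipation.

(** Gronwall's argument: [expR (c * t)] times the energy is nonincreasing, so each coordinate decays
    at rate [c / 2]. *)
Lemma energy_decay (R : realType) n (z v : R -> 'I_n -> R) (c : R) : 0 < c ->
  (forall (t : R) i, 0 < t -> is_derive t 1 (fun s => z s i) (v t i)) ->
  (forall t, 0 < t ->
     2 * \sum_i z t i * v t i <= - (c * \sum_i z t i ^+ 2)) ->
  forall i, z t i @[t --> +oo] --> (0 : R).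
Proof.
move=> c0 dz dissip i.
pose E t := \sum_i z t i ^+ 2.
pose g t := expR (c * t) * E t.
have dE (t : R) : 0 < t -> is_derive t 1 E (2 * \sum_i z t i * v t i).
  move=> t0; have -> : E = \sum_i (fun s => z s i ^+ 2).
    by apply/funext => s; rewrite fct_sumE.
  rewrite mulr_sumr; apply: is_derive_sum => j.
  have zj := dz t j t0; apply: is_derive_eq.
  by rewrite /GRing.scale/=; ring.
have dg (t : R) : 0 < t -> is_derive t 1 g
    (expR (c * t) * (2 * \sum_i z t i * v t i + c * E t)).
  move=> t0; have dEt := dE _ t0; rewrite /g; apply: is_derive_eq.
  by rewrite /GRing.scale/=; ring.
(* Starting at time 1 keeps the closed half-line inside the range of positive times, where the
   derivative is given. *)
have g1 t : 1 <= t -> g t <= g 1.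
  have pos (s : R) : 1 <= s -> 0 < s by exact: lt_le_trans.
  move=> t1; apply: (@ler0_derive1_nincry _ g 1) => //.
  - by move=> s; rewrite in_itv/= andbT => /ltW/pos/dg[].
  - move=> s; rewrite in_itv/= andbT => /ltW/pos s0.
    have := dg _ s0 => ?; rewrite derive1E derive_val mulr_ge0_le0 ?expR_ge0//.
    by rewrite addrC -[c * _]opprK addrC subr_le0 dissip.
  - apply: derivable_within_continuous => s.
    by rewrite in_itv/= andbT => /pos/dg[].
have c20 : 0 < c / 2 by rewrite divr_gt0.
apply: norm_cvg0.
apply: (@squeeze_cvgr _ _ _ _ (fun=> 0)
  (fun t => Num.sqrt (g 1) * expR (- (c / 2 * t)))).
- near=> t; rewrite normr_ge0 /=.
  have t1 : 1 <= t by near: t; exact: nbhs_pinfty_ge.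
  have E0 s : 0 <= E s by rewrite sumr_ge0// => j _; rewrite sqr_ge0.
  have g10 : 0 <= g 1 by rewrite mulr_ge0// expR_ge0.
  have : `|z t i| ^+ 2 <= (Num.sqrt (g 1) * expR (- (c / 2 * t))) ^+ 2.
    rewrite exprMn sqr_sqrtr// -expRM_natl real_normK ?num_real//.
    have -> : 2%:R * - (c / 2 * t) = - (c * t) by field.
    rewrite expRN ler_pdivlMr ?expR_gt0//; apply: le_trans (g1 _ t1).
    rewrite mulrC ler_wpM2l ?expR_ge0// /E (bigD1 i)//= lerDl.
    by rewrite sumr_ge0// => j _; rewrite sqr_ge0.
  by rewrite ler_pXn2r// nnegrE ?mulr_ge0 ?sqrtr_ge0 ?expR_ge0.
- exact: cvg_cst.
- rewrite -[X in _ --> X](mulr0 (Num.sqrt (g 1))); apply: cvgMl_tmp.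
  apply: (@cvg_comp _ _ _ (fun t => c / 2 * t) (fun t => expR (- t)) _ +oo).
    exact/gt0_cvgMry/cvg_id.
  exact: cvgr_expR.
Unshelve. all: by end_near. Qed.

(** * Existence of trajectories by power series *)

Section Exponential.
Context {R : realType}.

Lemma is_cvg_pseries_exp_bound (c : nat -> R) (B K t : R) :
  (forall k, `|c k| <= B * K ^+ k / k`!%:R) -> cvgn (pseries c t).
Proof.
move=> cB; apply: normed_cvg.
have cvgE : cvgn (series (fun k => B * exp_coeff (K * `|t|) k)).
  exact: (@is_cvg_seriesZ _ _ B (is_cvg_series_exp_coeff _)).
have le_term k : `|c k * t ^+ k| <= B * exp_coeff (K * `|t|) k.
  rewrite normrM normrX (le_trans (ler_wpM2r _ (cB k))) ?exprn_ge0//.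
  by rewrite /exp_coeff /= exprMn le_eqVlt; apply/orP; left; apply/eqP; ring.
by apply: series_le_cvg cvgE => k //=; exact: le_trans (le_term k).
Qed.

Lemma trajectory_exists n (M : 'M[R]_n) (x0 : 'cV[R]_n) :
  exists x, trajectory M x0 x.
Proof.
pose c i k : R := iter k (mulmx M) x0 i 0 / k`!%:R.
(* [K] dominates the absolute sum of each row of [M], and [B] every entry of [x0]; this gives the
   exponential bound on the iterates. *)
pose K := \sum_i \sum_j `|M i j|; pose B := \sum_i `|x0 i 0|.
have iterB k i : `|iter k (mulmx M) x0 i 0| <= B * K ^+ k.
  elim: k i => [|k IHk] i.
    by rewrite mulr1 /B (bigD1 i)//= lerDl sumr_ge0.
  rewrite iterS mxE (le_trans (ler_norm_sum _ _ _))//.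
  have term j : `|M i j * iter k (mulmx M) x0 j 0| <= `|M i j| * (B * K ^+ k).
    by rewrite normrM ler_wpM2l.
  rewrite (le_trans (ler_sum _ (fun j _ => term j)))//.
  rewrite -mulr_suml exprS [leRHS]mulrCA ler_wpM2r//.
    by rewrite (le_trans _ (IHk i)).
  by rewrite /K [leRHS](bigD1 i)//= lerDl sumr_ge0// => j _; rewrite sumr_ge0.
have diffsE i : pseries_diffs (c i) =
    fun k => iter k.+1 (mulmx M) x0 i 0 / k`!%:R.
  apply/funext => k; rewrite /pseries_diffs /c factS natrM.
  by rewrite invfM mulrCA mulVKf// pnatr_eq0.
have diffs2E i : pseries_diffs (pseries_diffs (c i)) =
    fun k => iter k.+2 (mulmx M) x0 i 0 / k`!%:R.
  apply/funext => k; rewrite diffsE /pseries_diffs factS natrM.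
  by rewrite invfM mulrCA mulVKf// pnatr_eq0.
(* The shifts [m] = 0, 1, 2 are the series and its first two formal derivatives, all needed for
   termwise differentiation. *)
have cvgc m i t :
    cvgn (pseries (fun k => iter (m + k) (mulmx M) x0 i 0 / k`!%:R) t).
  apply: (@is_cvg_pseries_exp_bound _ (B * K ^+ m) K) => k.
  by rewrite normrM normfV normr_nat ler_wpM2r ?invr_ge0// -mulrA -exprD.
pose x t : 'cV[R]_n := \col_i limn (pseries (c i) t).
have dx (t : R) i : is_derive t 1 (fun s => x s i 0) ((M *m x t) i 0).
  have -> : (fun s => x s i 0) = (fun s => limn (pseries (c i) s)).
    by apply/funext => s; rewrite mxE.
  have -> : (M *m x t) i 0 = limn (pseries (pseries_diffs (c i)) t).
    apply/esym/cvg_lim => //.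
    have -> : pseries (pseries_diffs (c i)) t =
        fun N => \sum_j M i j * pseries (c j) t N.
      apply/funext => N; rewrite /pseries/series/= diffsE.
      under [RHS]eq_bigr => j _ do rewrite mulr_sumr.
      rewrite exchange_big; apply: eq_bigr => k _ /=.
      rewrite mxE !mulr_suml; apply: eq_bigr => j _.
      by rewrite /c !mulrA.
    rewrite mxE; apply: cvg_big => [|j _]; first exact: add_continuous.
    by apply: cvgMl_tmp; rewrite mxE; exact: (cvgc 0%N).
  apply: (@pseries_snd_diffs _ (c i) (`|t| + 1)).
  - exact: (cvgc 0%N).
  - by rewrite diffsE; exact: (cvgc 1%N).
  - by rewrite diffs2E; exact: (cvgc 2%N).
  - by rewrite [ltRHS]ger0_norm ?addr_ge0// ltrDl.
have x00 : x 0 = x0.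
  apply/colP => i; rewrite mxE; apply: cvg_lim => //.
  rewrite -cvg_shiftS /= (_ : (fun _ => _) = cst (x0 i 0)); first exact: cvg_cst.
  apply/funext => k; rewrite /pseries/series/= big_nat_recl//= big1 ?addr0.
    by rewrite /c expr0 fact0 divr1 mulr1.
  by move=> j _; rewrite exprS mul0r mulr0.
exists x; split => // i.
(* The series is differentiable on both sides of 0, which yields right continuity there. *)
apply: cvg_at_right_filter; rewrite -[x0]x00.
apply: differentiable_continuous; apply/derivable1_diffP.
by case: (dx 0 i).
Qed.

End Exponential.

(** * Asymptotics of trajectories in the two cases *)

Section Consensus.
Context {R : realType} {n : nat} (G : signed_digraph R n).
Hypothesis hG : strongly_connected G.
Local Notation M := (- (minor_gain G *m laplacian G)).

Lemma solution_cvg0 (tau : 'I_n -> R) (z : R -> 'cV[R]_n) :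
  (forall x : 'cV_n,
     (forall i j, edge G j i -> x i 0 = Num.sg (weight G i j) * x j 0) ->
     \sum_i tau i * x i 0 = 0 -> x = 0) ->
  (forall (t : R) i, 0 < t ->
     is_derive t 1 (fun s => z s i 0) ((M *m z t) i 0)) ->
  (forall t, 0 < t -> \sum_i tau i * z t i 0 = 0) ->
  forall i, z t i 0 @[t --> +oo] --> (0 : R).
Proof.
move=> ker0 dz tauz; have [c c0 coer] := dissipation_coercive hG ker0.
apply: (energy_decay c0 dz) => t t0.
by rewrite energy_dissipation// lerN2 coer// tauz.
Qed.

Lemma unbalanced_stability : structurally_unbalanced G -> state_stability M.
Proof.
move=> unbal x0 x [_ _ dx]; apply: (@solution_cvg0 (fun=> 0)) => // [y hy _|t _].
  exact: unbalanced_ker0 hy.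
by rewrite big1// => i _; rewrite mul0r.
Qed.

Lemma balanced_consensus : structurally_balanced G -> signed_average_consensus M.
Proof.
move=> /balanced_gauge[sigma [pm1 gauge]] x0; exists sigma; split=> // x.
move=> [x00 x0r dx] i.
have n0 : n%:R != 0 :> R.
  by rewrite pnatr_eq0 -lt0n (leq_ltn_trans _ (ltn_ord i)).
pose s t := \sum_i sigma i * x t i 0.
have ds (t : R) : 0 < t -> is_derive t 1 s 0.
  move=> t0; have -> : s = \sum_i (fun u => sigma i * x u i 0).
    by apply/funext => u; rewrite fct_sumE.
  rewrite -(gauge_conserved hG pm1 gauge (x t)); apply: is_derive_sum => j.
  exact: (is_deriveZ (sigma j) (dx t j t0)).
have s_const t u : 0 < t -> t <= u -> s u = s t.
  move=> t0 tu.
  have dsI (r : R) : t <= r -> is_derive r 1 s 0 by move=> /(lt_le_trans t0)/ds.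
  have cs : {within `[t, +oo[, continuous s}.
    by apply: derivable_within_continuous => r; rewrite in_itv/= andbT => /dsI[].
  have dI (r : R) : r \in `]t, +oo[%R -> derivable s r 1 /\ derive1 s r = 0.
    rewrite in_itv/= andbT => /ltW/dsI dr; split; first by case: dr.
    by rewrite derive1E derive_val.
  apply/eqP; rewrite eq_le.
  rewrite (@ler0_derive1_nincry _ s t) ?(@ger0_derive1_ndecry _ s t)//;
    by move=> r /dI[// _ ->].
(* A trajectory is tied to [x0] only through its right limit at 0, so the constant value of [s] on
   positive times is identified by that limit. *)
have s_cvg : s t @[t --> 0^'+] --> \sum_i sigma i * x0 i 0.
  apply: cvg_big => [|j _]; first exact: add_continuous.
  exact: cvgMl_tmp.
have sE t : 0 < t -> s t = \sum_i sigma i * x0 i 0.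
  move=> t0; apply: (cvg_unique _ _ s_cvg) => //.
  apply: cvg_near_cst; near=> u; apply/esym/s_const; near: u.
    exact: nbhs_right_gt.
  exact: nbhs_right_le.
(* [m] is the coefficient of the orthogonal projection of [x0] on [sigma], whose squared norm is
   [n]; [z] is thus orthogonal to [sigma] at positive times. *)
pose m := (\sum_j sigma j * x0 j 0) / n%:R.
pose z t := x t - m *: \col_i sigma i.
have zE t j : z t j 0 = x t j 0 - m * sigma j by rewrite !mxE.
have z0 : z t i 0 @[t --> +oo] --> (0 : R).
  apply: (solution_cvg0 (gauge_ker0 hG pm1 gauge)).
    move=> t j t0; have dxj := dx t j t0.
    have -> : (fun s => z s j 0) = (fun s => x s j 0) - cst (m * sigma j).
      by apply/funext => r; rewrite zE.
    rewrite mulmxBr -scalemxAr gained_laplacian_gauge// scaler0 subr0.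
    by apply: is_derive_eq; rewrite subr0.
  move=> t t0; under eq_bigr => j _ do rewrite zE mulrBr mulrCA gauge_sqr// mulr1.
  by rewrite sumrB -/(s t) sE// sumr_const card_ord -[m *+ n]mulr_natr divfK ?subrr.
have -> : sigma i / n%:R * \sum_j sigma j * x0 j 0 = 0 + m * sigma i.
  by rewrite /m; ring.
have -> : (fun t => x t i 0) = (fun t => z t i 0 + m * sigma i).
  by apply/funext => t; rewrite zE subrK.
by apply: cvgD => //; exact: cvg_cst.
Unshelve. all: by end_near. Qed.

(** The gauge vector is a nonzero equilibrium. *)
Lemma balanced_not_stable : (0 < n)%N -> structurally_balanced G ->
  ~ state_stability M.
Proof.
move=> n0 /balanced_gauge[sigma [pm1 gauge]] stab; pose i := Ordinal n0.
have /stab/(_ i) : trajectory M (\col_i sigma i) (fun=> \col_i sigma i).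
  split=> // [j|t j _]; first exact: cvg_cst.
  by rewrite gained_laplacian_gauge// !mxE; exact: is_derive_cst.
rewrite !mxE => lim0.
have /eqP : sigma i = 0 by apply: (cvg_unique _ _ lim0) => //; exact: cvg_cst.
by case: (pm1 i) => ->; rewrite ?oppr_eq0 oner_eq0.
Qed.

(** Starting from the basis vector at [i], the consensus value at [i] is [1 / n] for any choice of
    signs, whereas stability makes the limit 0. *)
Lemma unbalanced_not_consensus : (0 < n)%N -> structurally_unbalanced G ->
  ~ signed_average_consensus M.
Proof.
move=> n0 unbal cons; pose i := Ordinal n0; pose e : 'cV[R]_n := delta_mx i 0.
have [x tx] := trajectory_exists M e.
have [sigma [pm1 /(_ x tx i) xl]] := cons e.
have : sigma i / n%:R * \sum_j sigma j * e j 0 = 0.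
  by apply: (cvg_unique _ xl) => //; exact: (unbalanced_stability unbal tx).
have -> : \sum_j sigma j * e j 0 = sigma i.
  rewrite (bigD1 i)//= big1 => [|j /negPf ji]; rewrite !mxE ?eqxx.
    by rewrite mulr1 addr0.
  by rewrite ji mulr0.
move/eqP; rewrite mulrAC gauge_sqr// mul1r invr_eq0 pnatr_eq0.
by rewrite gtn_eqF.
Qed.

End Consensus.

Theorem theorem2 (R : realType) (n : nat) (hn : (0 < n)%N)
    (G : signed_digraph R n) (hG : strongly_connected G) :
  (signed_average_consensus (- (minor_gain G *m laplacian G))
     <-> structurally_balanced G) /\
  (state_stability (- (minor_gain G *m laplacian G))
     <-> structurally_unbalanced G).
Proof.
split; split.
- by move=> cons; apply: contrapT => /(unbalanced_not_consensus hG hn).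
- exact: balanced_consensus.
- by move=> stab /(balanced_not_stable hn).
- exact: unbalanced_stability.
Qed.
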